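(* Let $n\ge 1$ and $d\ge 3$ be integers and put $s=d-3$. Then the chamber-to-class map $$\Psi_{d,n}\colon \operatorname{Ch}\bigl(\mathcal H_n^{(d)}\bigr)\longrightarrow \{\mathtt a,\mathtt b\}^n/{\approx_s},\qquad C\longmapsto \bigl[\,W(\lambda_{\Delta(C)})\,\bigr]_s,$$ is a bijection.
   Context: **Arrangement.** For $i\in\{1,\dots,n\}$ let $H_i^{(d)}=\{x\in\mathbb R^d: 1+i x_1+i^2x_2+\cdots+i^dx_d=0\}$ and $\mathcal H_n^{(d)}=\{H_1^{(d)},\dots,H_n^{(d)}\}$. A chamber is a connected component of $\mathbb R^d\setminus\bigcup_i H_i^{(d)}$; $\operatorname{Ch}(\mathcal H_n^{(d)})$ is the set of chambers. For $x\in\mathbb R^d$ put $P_x(t)=1+x_1t+\cdots+x_dt^d$. The sign word of a chamber $C$ is $\sigma(C)=\sigma_1\cdots\sigma_n\in\{+,-\}^n$ with $\sigma_i=\operatorname{sgn}P_x(i)$ for any $x\in C$ (independent of the choice of $x$). The address of $C$ is $\Delta(C)\subseteq\{1,\dots,n\}$, the set of sign-change positions of the augmented word $+\sigma(C)$: with $\sigma_0:=+$, $\Delta(C)=\{i\in\{1,\dots,n\}:\sigma_{i-1}\ne\sigma_i\}$. It always satisfies $\#\Delta(C)\le d=s+3$. **Words.** For words $w,v$, $\binom{w}{v}$ is the number of occurrences of $v$ as a scattered subword of $w$ (number of index subsequences of $w$ spelling $v$); $|w|_{\mathtt a}$ is the number of letters $\mathtt a$ in $w$. For $u,w\in\{\mathtt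 a,\mathtt b\}^n$: $u\sim_2 w$ iff $|u|_{\mathtt a}=|w|_{\mathtt a}$ and $\binom{u}{\mathtt{ab}}=\binom{w}{\mathtt{ab}}$. For $w\in\{\mathtt a,\mathtt b\}^n$ let $\lambda(w)=(r_1,\dots,r_{|w|_{\mathtt a}})$ where $r_i$ is the number of $\mathtt b$'s to the right of the $i$-th $\mathtt a$ (so $r_1\ge r_2\ge\cdots\ge0$). For $s\ge0$ let $\ell=\min(s,|w|_{\mathtt a})$; the $s$-tail of $w$ is $\mathcal T_s(w)=(r_{|w|_{\mathtt a}},r_{|w|_{\mathtt a}-1},\dots,r_{|w|_{\mathtt a}-\ell+1})$ (empty if $\ell=0$). Define $u\approx_s w$ iff $u\sim_2 w$ and $\mathcal T_s(u)=\mathcal T_s(w)$; $[w]_s$ denotes the $\approx_s$-class of $w$ in $\{\mathtt a,\mathtt b\}^n$. **Words from partitions.** For $0\le j\le n$ and a weakly decreasing sequence $\lambda=(r_1,\dots,r_j)$ of integers in $[0,n-j]$ (exactly $j$ parts, zeros allowed), $W(\lambda)=\mathtt b^{(n-j)-r_1}\mathtt a\,\mathtt b^{r_1-r_2}\mathtt a\cdots \mathtt b^{r_{j-1}-r_j}\mathtt a\,\mathtt b^{r_j}$, and $W(\varnothing)=\mathtt b^n$. **The partition $\lambda_\Delta$.** Let $\Delta=\{c_1<\cdots<c_r\}\subseteq\{1,\dots,n\}$ with $r\le s+3$. Exponents denote repetition of a part; exponent $0$ means the part is absent. - Case I, $r\le s$: $\lambda_\Delta=(c_r-r,\,c_{r-1}-(r-1),\dots,c_1-1)$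 (empty if $r=0$). - Case II, $r=s+1$: if $s\ge1$, $\lambda_\Delta=\bigl((c_s-s)^{\,n-c_{s+1}+2},\,c_{s-1}-(s-1),\dots,c_1-1\bigr)$; if $s=0$, $\lambda_\Delta=(0^{\,n-c_1+1})$. - Case III, $r\in\{s+2,s+3\}$: if $r=s+2$ adjoin $c_{s+3}:=n+1$, so that in either case we have $c_1<\cdots<c_{s+3}$. If $s\ge1$, $\lambda_\Delta=\bigl((c_{s+2}-s-1)^{\,c_{s+3}-c_{s+2}-1},\,c_{s+1}-s,\,(c_s-s)^{\,n-c_{s+3}+2},\,c_{s-1}-(s-1),\dots,c_1-1\bigr)$; if $s=0$, $\lambda_\Delta=\bigl((c_2-1)^{\,c_3-c_2-1},\,c_1,\,0^{\,n-c_3+1}\bigr)$. (When $s=1$ the final list $c_{s-1}-(s-1),\dots,c_1-1$ is empty.) In every case $\lambda_\Delta$ is weakly decreasing with $j$ parts in $[0,n-j]$ for some $j\le n$, so $W(\lambda_\Delta)\in\{\mathtt a,\mathtt b\}^n$ is defined. *)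

(* Defs.v *)
From HB Require Import structures.
From mathcomp Require Import all_boot all_order all_algebra.
From mathcomp Require Import all_classical all_reals all_analysis.
Set Implicit Arguments.
Unset Strict Implicit.
Unset Printing Implicit Defensive.
Import Order.TTheory GRing.Theory Num.Theory.
Import numFieldNormedType.Exports.
Local Open Scope classical_set_scope.
Local Open Scope ring_scope.

(* The coordinate [x_k] of a point of R^d, for [1 <= k <= d], is [x 0 (k - 1)];
   this accounts for the shifted exponents [k.+1] below. *)

Definition hyperplane (R : realType) (d i : nat) : set 'rV[R]_d :=
  [set x | 1 + \sum_(k < d) i%:R ^+ k.+1 * x 0 k = 0].

Definition arrangement_complement (R : realType) (n d : nat) : set 'rV[R]_d :=
  ~` \bigcup_(i in [set i | (1 <= i <= n)%N]) @hyperplane R d i.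

Definition chambers (R : realType) (n d : nat) : set (set 'rV[R]_d) :=
  connected_component (@arrangement_complement R n d)
    @` @arrangement_complement R n d.

Definition point_poly (R : realType) (d : nat) (x : 'rV[R]_d) : {poly R} :=
  1 + \sum_(k < d) x 0 k *: 'X^(k.+1).

(* Signs are [Num.sg] values in [{1, -1}]; the value does not depend on the
   point of the chamber that is chosen, see [sign_word_indep]. *)
Definition sign_word_at (R : realType) (n d : nat) (x : 'rV[R]_d) : seq R :=
  [seq Num.sg (point_poly x).[i%:R] | i <- iota 1 n].

Definition sign_word (R : realType) (n d : nat) (C : set 'rV[R]_d) : seq R :=
  sign_word_at n (xget 0 C).

(* Sign-change positions of the augmented word, listed increasingly; a subset
   [c_1 < ... < c_r] of [{1, ..., n}] is represented by this list throughout. *)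
Definition address (R : realType) (n d : nat) (C : set 'rV[R]_d) : seq nat :=
  let w := 1 :: sign_word n C in
  [seq i <- iota 1 n | w`_i.-1 != w`_i].

(* The letter [a] is [true] and the letter [b] is [false]. *)
Notation letter := bool (only parsing).
Notation la := true (only parsing).
Notation lb := false (only parsing).

(* An index subsequence of [w] is a bit mask of the same length. *)
Definition subword_count (w v : seq letter) : nat :=
  #|[set m : (size w).-tuple bool | mask m w == v]%SET|.

Definition sim2 (u w : seq letter) : bool :=
  (count_mem la u == count_mem la w) &&
  (subword_count u [:: la; lb] == subword_count w [:: la; lb]).

Definition lambda_of_word (w : seq letter) : seq nat :=
  [seq count_mem lb (drop i.+1 w) | i <- iota 0 (size w) & nth lb w i == la].

Definition tail_of_word (s : nat) (w : seq letter) : seq nat :=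
  take (minn s (count_mem la w)) (rev (lambda_of_word w)).

Definition approx (s : nat) (u w : seq letter) : bool :=
  sim2 u w && (tail_of_word s u == tail_of_word s w).

Definition approx_class (n s : nat) (w : n.-tuple letter) :
  {set n.-tuple letter} := [set u : n.-tuple letter | approx s u w]%SET.

Definition approx_classes (n s : nat) : set {set n.-tuple letter} :=
  range (@approx_class n s).

(* [word_rec m (r_1, ..., r_j)] is
   [b^(m - r_1) a b^(r_1 - r_2) a ... b^(r_(j-1) - r_j) a b^(r_j)]. *)
Fixpoint word_rec (m : nat) (l : seq nat) : seq letter :=
  if l is r :: l' then nseq (m - r) lb ++ la :: word_rec r l' else nseq m lb.

Definition partition_in_box (n : nat) (l : seq nat) : bool :=
  [&& (size l <= n)%N, sorted geq l & all (fun r => r <= n - size l)%N l].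

(* The default of [insubd] is not used when [partition_in_box n l] holds, see
   [word_of_partitionE]. *)
Definition word_of_partition (n : nat) (l : seq nat) : n.-tuple letter :=
  insubd (nseq_tuple n lb) (word_rec (n - size l) l).

Section LambdaDelta.
Variables (s n : nat) (D : seq nat).

(* [c_i], with [c_i = n + 1] for [i] beyond the number of elements of [D]. *)
Let c (i : nat) : nat := nth n.+1 D i.-1.

(* [(c_k - k, c_(k-1) - (k-1), ..., c_1 - 1)] *)
Let shifted (k : nat) : seq nat := [seq c i - i | i <- rev (iota 1 k)]%N.

(* Intended for [size D <= s + 3].  The exponent [n + 2 - c_i] must not be
   written [n - c_i + 2], since [c_i] may be [n + 1] and subtraction is
   truncated. *)
Definition lambda_delta : seq nat :=
  (if size D <= s then shifted (size D)
   else if size D == s.+1 then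
     if s == 0 then nseq (n + 1 - c 1) 0
     else nseq (n + 2 - c s.+1) (c s - s) ++ shifted s.-1
   else
     if s == 0 then nseq (c 3 - c 2 - 1) (c 2 - 1) ++ c 1 :: nseq (n + 1 - c 3) 0
     else nseq (c s.+3 - c s.+2 - 1) (c s.+2 - s - 1)
            ++ (c s.+1 - s) :: nseq (n + 2 - c s.+3) (c s - s)
            ++ shifted s.-1)%N.

End LambdaDelta.

Definition chamber_class (R : realType) (n d s : nat) (C : set 'rV[R]_d) :
  {set n.-tuple letter} :=
  approx_class s (word_of_partition n (lambda_delta s n (address n C))).

Lemma size_word_rec (m : nat) (l : seq nat) :
  sorted geq l -> all (fun r => r <= m)%N l ->
  size (word_rec m l) = (m + size l)%N.
Proof.
elim: l m => [|r l IH] m /=; first by rewrite size_nseq addn0.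
move=> srt /andP[rm _]; rewrite size_cat size_nseq /= IH ?(path_sorted srt) //.
  by rewrite !addnS addnA subnK.
by apply: (order_path_min _ srt) => x y z yx zy; exact: leq_trans zy yx.
Qed.

Lemma word_of_partitionE (n : nat) (l : seq nat) :
  partition_in_box n l ->
  word_of_partition n l = word_rec (n - size l) l :> seq letter.
Proof.
by case/and3P=> ln srt bd; rewrite val_insubd size_word_rec // subnK // eqxx.
Qed.

Lemma horner_point_poly (R : realType) (d : nat) (x : 'rV[R]_d) (t : R) :
  (point_poly x).[t] = 1 + \sum_(k < d) t ^+ k.+1 * x 0 k.
Proof.
rewrite /point_poly hornerD hornerC horner_sum; congr (_ + _).
by apply: eq_bigr => k _; rewrite hornerZ hornerXn mulrC.
Qed.

Lemma sign_word_indep (R : realType) (n d : nat) (C : set 'rV[R]_d)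
    (x : 'rV[R]_d) :
  chambers n C -> C x -> sign_word n C = sign_word_at n x.
Proof.
move=> [z Sz <-] Cx; rewrite /sign_word.
set C' := connected_component _ _ in Cx *; set y := xget 0 C'.
have Cy : C' y by rewrite /y; case: xgetP => [w _ //|/(_ x)].
apply/eq_in_map => i; rewrite mem_iota => /andP[i1]; rewrite add1n ltnS => iN.
pose f (w : 'rV[R]_d) : R := (point_poly w).[i%:R].
have f0 w : C' w -> f w != 0.
  move=> /connected_component_sub Sw; apply/eqP => fw; apply: Sw.
  by exists i; [rewrite /= i1|rewrite /hyperplane/= -horner_point_poly].
have cf : continuous f.
  have cs (r : seq 'I_d) :
      continuous (fun w : 'rV[R]_d => \sum_(k <- r) i%:R ^+ k.+1 * w 0 k : R^o).
    elim: r => [|k r IH] w.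
      by under eq_fun do rewrite big_nil; exact: cst_continuous.
    under eq_fun do rewrite big_cons.
    have ck : {for w, continuous
        (fun v : 'rV[R]_d => i%:R ^+ k.+1 * v 0 k : R^o)}.
      apply: (@continuousM _ _ (cst (i%:R ^+ k.+1))).
        exact: cst_continuous.
      exact: coord_continuous.
    exact: (continuousD ck (IH w)).
  rewrite /f; under eq_fun do rewrite horner_point_poly.
  move=> w; have c1 : {for w, continuous (fun=> 1 : R^o)}.
    exact: cst_continuous.
  exact: (continuousD c1 (cs _ w)).
have itv : is_interval (f @` C').
  apply/connected_intervalP/connected_continuous_connected.
    exact: component_connected.
  exact: continuous_subspaceT.
have no a b : C' a -> C' b -> f a < 0 -> 0 < f b -> False.
  move=> Ca Cb fa fb.
  have [w Cw fw] : (f @` C') 0.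
    apply: (itv (f a) (f b)); [by exists a|by exists b|].
    by rewrite !ltW.
  by have := f0 _ Cw; rewrite fw eqxx.
have := f0 _ Cx; have := f0 _ Cy; rewrite -/(f y) -/(f x).
rewrite !neq_lt => /orP[fy|fy] /orP[fx|fx].
- by rewrite !ltr0_sg.
- by case: (no y x).
- by case: (no x y).
- by rewrite !gtr0_sg.
Qed.

(* Main.v *)
Require Import Defs.
From mathcomp Require Import all_boot all_order all_algebra.
From mathcomp Require Import all_classical all_reals all_analysis.
From mathcomp Require Import zify ring lra.
From mathcomp Require Import polyrcf.
Set Implicit Arguments.
Unset Strict Implicit.
Unset Printing Implicit Defensive.
Import Order.TTheory GRing.Theory Num.Theory.
Import numFieldNormedType.Exports.

(* A chamber is determined by the signs of [P_x] at [1, ..., n], hence by its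
   address, and the addresses are exactly the subsets with at most [d] elements:
   every sign change costs [P_x] a real root, and conversely the polynomial with
   constant coefficient 1 and roots [c - 1/2], for [c] in the subset, realizes
   it.

   A class of [approx s] is the number [j] of parts of the partition of a word,
   their sum, and the [s] smallest parts.  If [j <= s] this is the whole
   partition, and [c_i - i] turns strictly increasing sequences into weakly
   increasing ones.  If [j > s], the [m = j - s] parts outside the tail lie
   between the last part [T] of the tail and [A = n - j], so their sum is [m T]
   (Case II) or [m T + 1 + v] with [v < m (A - T)] (Case III); the quotient and
   the remainder of [v] by [A - T] are read off the last and the first of the
   three remaining elements of the address, the middle one giving [j]. *)

(** * Partitions of words *)

(** Masks are split by their first bit. [P] lives on sequences so that it applies to tuples of both
    lengths. *)
Lemma card_tuple_cons (n : nat) (P : pred (seq bool)) :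
  #|[set m : n.+1.-tuple bool | P m]%SET| =
  (#|[set m : n.-tuple bool | P (true :: m)]%SET| +
   #|[set m : n.-tuple bool | P (false :: m)]%SET|)%N.
Proof.
pose f (b : bool) (m : n.-tuple bool) := [tuple of b :: m].
have fI b : injective (f b) by move=> m1 m2 /(congr1 val)[] /val_inj.
rewrite -(card_imset _ (fI true)) -(card_imset _ (fI false)).
set A := imset _ _; set B := imset (f false) _.
have dAB : [disjoint A & B].
  rewrite disjoint_subset; apply/fintype.subsetP => _ /imsetP[m1 _ ->].
  by rewrite inE; apply/imsetP => -[m2 _ /(congr1 val)].
have /eqP <- : #|A :|: B|%SET == (#|A| + #|B|)%N by rewrite (leq_card_setU A B).2.
apply: eq_card => m; rewrite !inE; apply/idP/orP.
  by case/tupleP: m => -[] m Pm; [left|right]; apply/imsetP; exists m; rewrite ?inE.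
by case=> /imsetP[m']; rewrite inE => Pm ->.
Qed.

Lemma subword_count_nil v : subword_count [::] v = (v == [::]).
Proof.
rewrite /subword_count /=; case: v => [|y v].
  rewrite -[RHS](card_tuple 0 bool); apply: eq_card => m.
  by rewrite !inE mask0.
by apply: eq_card0 => m; rewrite !inE mask0.
Qed.

Lemma subword_count_cons x w v :
  subword_count (x :: w) v =
  ((if v is y :: v' then (x == y) * subword_count w v' else 0)
   + subword_count w v)%N.
Proof.
rewrite /subword_count (card_tuple_cons _ (fun m => mask m (x :: w) == v)) /=.
congr addn; case: v => [|y v]; first by apply: eq_card0 => m; rewrite !inE.
case: eqP => [->|xy]; rewrite ?mul1n ?mul0n; last first.
  by apply: eq_card0 => m; rewrite !inE eqseq_cons; case: eqP.
by apply: eq_card => m; rewrite !inE eqseq_cons eqxx.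
Qed.

Lemma lambda_of_word_cons x w :
  lambda_of_word (x :: w) =
  if x then count_mem false w :: lambda_of_word w else lambda_of_word w.
Proof.
rewrite /lambda_of_word /= (iotaDl 1 0) filter_map.
by case: x => /=; rewrite -map_comp ?drop0.
Qed.

(** Each [a] starts as many occurrences of [ab] as there are [b]'s to its right. Hence [sim2]
    compares the number and the sum of the parts. *)
Lemma subword_count_ab w :
  subword_count w [:: true; false] = sumn (lambda_of_word w).
Proof.
have c0 u : subword_count u [::] = 1%N.
  by elim: u => [|x u IH]; rewrite ?subword_count_nil ?subword_count_cons.
have c1 u : subword_count u [:: false] = count_mem false u.
  elim: u => [|x u IH]; rewrite ?subword_count_nil ?subword_count_cons //=.
  by rewrite c0 IH muln1.
elim: w => [|x w IH]; first by rewrite subword_count_nil.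
rewrite subword_count_cons lambda_of_word_cons c1 IH.
by case: x; rewrite ?mul1n ?mul0n.
Qed.

Lemma size_lambda_of_word w : size (lambda_of_word w) = count_mem true w.
Proof.
by elim: w => // -[] w IH; rewrite lambda_of_word_cons /= IH.
Qed.

Lemma lambda_of_word_in_box w : partition_in_box (size w) (lambda_of_word w).
Proof.
have ct u : (count_mem true u + count_mem false u = size u)%N.
  by elim: u => //= -[] u <- /=; lia.
rewrite /partition_in_box size_lambda_of_word count_size /=.
have -> : (size w - count_mem true w)%N = count_mem false w by rewrite -(ct w) addKn.
suff: all (fun r => r <= count_mem false w)%N (lambda_of_word w) &&
  sorted geq (lambda_of_word w) by rewrite andbC.
elim: w => // x w /andP[bd srt]; rewrite lambda_of_word_cons; case: x => /=.
  rewrite leqnn bd /= path_min_sorted //.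
rewrite srt andbT; apply: sub_all bd => r /=; lia.
Qed.

Lemma lambda_of_word_rec m l : sorted geq l -> all (fun r => r <= m)%N l ->
  lambda_of_word (word_rec m l) = l.
Proof.
have nseqE k u : lambda_of_word (nseq k false ++ u) = lambda_of_word u.
  by elim: k => //= k IH; rewrite lambda_of_word_cons.
(* The block lengths telescope: a word built with bound [m'] has [m'] letters [b], which recovers
   each part. *)
have cntE l' m' : sorted geq l' -> all (fun r => r <= m')%N l' ->
   count_mem false (word_rec m' l') = m'.
  elim: l' m' => [|r l' IH] m' /=; first by rewrite count_nseq /= mul1n.
  move=> srt /andP[rm _]; rewrite count_cat count_nseq /= IH ?(path_sorted srt) //.
    lia.
  by apply: (order_path_min _ srt) => x y z yx zy; exact: leq_trans zy yx.
elim: l m => [|r l IH] m /=; first by rewrite -[nseq _ _]cats0 nseqE.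
move=> srt /andP[rm _]; have rl : all (fun i => i <= r)%N l.
  by apply: (order_path_min _ srt) => x y z yx zy; exact: leq_trans zy yx.
by rewrite nseqE lambda_of_word_cons IH ?cntE ?(path_sorted srt).
Qed.

(* Partitions are weakly decreasing, so [take s (rev l)] is the [s]-tail. *)
Definition partition_key (s : nat) (l : seq nat) : nat * nat * seq nat :=
  (size l, sumn l, take s (rev l)).

(* Unqualified, [approx] is the approximation by simple functions. *)
Lemma approxE s u w :
  Defs.approx s u w = (partition_key s (lambda_of_word u) ==
                  partition_key s (lambda_of_word w)).
Proof.
rewrite /Defs.approx /sim2 /tail_of_word !subword_count_ab -!size_lambda_of_word.
rewrite /partition_key !xpair_eqE.
rewrite -(size_rev (lambda_of_word u)) -(size_rev (lambda_of_word w)).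
(* The [minn] of [tail_of_word] is absorbed, since [take] stops at the end of the list anyway. *)
by rewrite !take_min !take_size.
Qed.

Lemma approx_class_eq n s (u w : n.-tuple bool) :
  approx_class s u = approx_class s w <->
  partition_key s (lambda_of_word u) = partition_key s (lambda_of_word w).
Proof.
split=> [/setP/(_ u)|E]; first by rewrite !inE !approxE eqxx => /esym/eqP.
by apply/setP => v; rewrite !inE !approxE E.
Qed.

Lemma lambda_of_word_of_partition n l : partition_in_box n l ->
  lambda_of_word (word_of_partition n l) = l.
Proof.
move=> bl; rewrite word_of_partitionE //; case/and3P: bl => _ srt bd.
exact: lambda_of_word_rec.
Qed.

(** * Partitions of subsets *)

(* [path ltn 0 D] says both that [D] is increasing and that it avoids [0]. *)
Definition subset_list (n : nat) (D : seq nat) : bool :=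
  path ltn 0 D && (last 0 D <= n)%N.

Definition unshift (D : seq nat) : seq nat :=
  mkseq (fun i => nth 0 D i - i.+1)%N (size D).

Definition shift (e : seq nat) : seq nat :=
  mkseq (fun i => nth 0 e i + i.+1)%N (size e).

Lemma size_unshift D : size (unshift D) = size D.
Proof. by rewrite size_mkseq. Qed.

Lemma size_shift e : size (shift e) = size e.
Proof. by rewrite size_mkseq. Qed.

Lemma unshift_rcons D t :
  unshift (rcons D t) = rcons (unshift D) (t - (size D).+1)%N.
Proof.
rewrite /unshift size_rcons mkseqS nth_rcons ltnn eqxx; congr rcons.
by apply/eq_in_map => i; rewrite mem_iota /= nth_rcons => ->.
Qed.

Lemma shift_rcons e r : shift (rcons e r) = rcons (shift e) (r + (size e).+1)%N.
Proof.
rewrite /shift size_rcons mkseqS nth_rcons ltnn eqxx; congr rcons.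
by apply/eq_in_map => i; rewrite mem_iota /= nth_rcons => ->.
Qed.

Lemma last_unshift D : last 0 (unshift D) = (last 0 D - size D)%N.
Proof.
by case/lastP: D => // D t; rewrite unshift_rcons !last_rcons size_rcons.
Qed.

Lemma last_shift e : last 0 (shift e) = (last 0 e + size e)%N.
Proof.
by case/lastP: e => // e r; rewrite shift_rcons !last_rcons size_rcons.
Qed.

(** This makes the truncated subtractions in [unshift] exact. *)
Lemma size_ltn_path D : path ltn 0 D -> (size D <= last 0 D)%N.
Proof.
elim/last_ind: D => // D t IH; rewrite rcons_path last_rcons size_rcons.
by case/andP=> /IH /leq_ltn_trans h /h.
Qed.

Lemma path_unshift D : path ltn 0 D -> path leq 0 (unshift D).
Proof.
elim/last_ind: D => // D t IH; rewrite unshift_rcons !rcons_path.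
case/andP=> pD tD; rewrite IH //= last_unshift.
by move: tD => /=; lia.
Qed.

Lemma path_shift e : path leq 0 e -> path ltn 0 (shift e).
Proof.
elim/last_ind: e => // e r IH; rewrite shift_rcons !rcons_path.
case/andP=> pe re; rewrite IH //= last_shift.
by move: re => /=; lia.
Qed.

Lemma shiftK : cancel shift unshift.
Proof.
elim/last_ind=> // e r IH.
by rewrite shift_rcons unshift_rcons IH size_shift addnK.
Qed.

Lemma unshiftK D : path ltn 0 D -> shift (unshift D) = D.
Proof.
elim/last_ind: D => // D t IH; rewrite rcons_path => /andP[pD tD].
rewrite unshift_rcons shift_rcons IH // size_unshift subnK //.
exact: leq_ltn_trans (size_ltn_path pD) tD.
Qed.

(** Recognizes the list [shifted] of [lambda_delta]. The suffix [D'] allows for Cases II and III,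
    where only a proper prefix of the subset is shifted. *)
Lemma map_rev_iota_unshift (x0 : nat) (D D' : seq nat) :
  [seq nth x0 (D ++ D') i.-1 - i | i <- rev (iota 1 (size D))]%N =
  rev (unshift D).
Proof.
rewrite map_rev (iotaDl 1 0) -map_comp; congr rev.
apply/eq_in_map => i; rewrite mem_iota add0n /= => iD.
by rewrite add1n /= nth_cat iD (set_nth_default 0).
Qed.

(** * The partition of a subset, smallest part first, so that the tail is a prefix *)

Section RevLambdaDelta.
Variables (s n : nat).

Lemma rev_lambda_delta_small D : (size D <= s)%N ->
  rev (lambda_delta s n D) = unshift D.
Proof.
move=> Ds; rewrite /lambda_delta Ds -{1}[D]cats0.
by rewrite map_rev_iota_unshift revK.
Qed.

(** One of the [n + 2 - x] equal parts belongs to the tail, which leaves [n + 1 - x] copies. For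
    [s = 0] the default [0] of [last] is the repeated part. *)
Lemma rev_lambda_delta_mid D x : size D = s -> (x <= n)%N ->
  rev (lambda_delta s n (rcons D x)) =
  unshift D ++ nseq (n.+1 - x) (last 0 (unshift D)).
Proof.
move=> Ds xn; rewrite /lambda_delta size_rcons Ds ltnn eqxx.
case/lastP: D Ds => [<-|D t <-] /=; first by rewrite rev_nseq addn1.
rewrite size_rcons -[rcons (rcons D t) x]cats1 cat_rcons /=.
rewrite map_rev_iota_unshift rev_cat revK rev_nseq.
rewrite unshift_rcons last_rcons cat_rcons !nth_cat ltnn subnn /=.
rewrite ltnNge leqnSn subSnn /= addn2 subSn //.
exact: leq_trans xn _.
Qed.

(** [head n.+1 D'] is $c_{s+3}$; its default is the adjoined value [n + 1]. *)
Lemma rev_lambda_delta_large D x y D' : size D = s ->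
  (head n.+1 D' <= n.+1)%N ->
  rev (lambda_delta s n (D ++ x :: y :: D')) =
  unshift D ++ nseq (n.+1 - head n.+1 D') (last 0 (unshift D))
    ++ (x - s)%N :: nseq (head n.+1 D' - y - 1) (y - s - 1).
Proof.
move=> Ds zn; rewrite /lambda_delta size_cat /= Ds.
have [-> ->] : (s + (size D').+2 <= s)%N = false /\
  (s + (size D').+2 == s.+1)%N = false by split; lia.
have nz : nth n.+1 D' 0 = head n.+1 D' by case: D' {zn}.
have nthS k : nth n.+1 (D ++ x :: y :: D') (s + k)%N = nth n.+1 (x :: y :: D') k.
  by rewrite nth_cat -Ds ltnNge leq_addr addKn.
have := nthS 0; have := nthS 1; have := nthS 2; rewrite addn0 addn1 addn2 /= nz.
move=> -> -> ->.
case/lastP: D Ds {nthS} => [<-|D t <-] /=.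
  by rewrite rev_cat rev_cons !rev_nseq cat_rcons !subn0 nz addn1.
rewrite size_rcons cat_rcons /= map_rev_iota_unshift.
rewrite unshift_rcons last_rcons cat_rcons nth_cat ltnn subnn /=.
rewrite rev_cat rev_cons rev_cat revK !rev_nseq cat_rcons -!catA /= addn2.
by rewrite subSn // nz.
Qed.

End RevLambdaDelta.

(** In increasing order, only the last part has to be compared with the side of the box. *)
Lemma partition_in_boxE n l : partition_in_box n l =
  [&& (size l <= n)%N, path leq 0 (rev l) & (last 0 (rev l) <= n - size l)%N].
Proof.
have p0 u : path leq 0 u = sorted leq u by rewrite path_min_sorted // all_predT.
rewrite /partition_in_box p0 rev_sorted; congr andb.
case: l => [|r l] //=; rewrite rev_cons last_rcons.
have [srt|] := boolP (path _ r l); last by [].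
rewrite /=; case rn: (r <= _)%N => //=.
apply: sub_all (order_path_min _ srt) => [u /= ur|u v w /= vu uw].
  exact: leq_trans rn.
exact: leq_trans uw vu.
Qed.

(* The shapes of a subset with at most [s + 3] elements in Cases I, II, III. *)
Lemma seq_split3 (s : nat) (D : seq nat) : (size D <= s + 3)%N ->
  [\/ (size D <= s)%N,
      exists D1 x, size D1 = s /\ D = rcons D1 x |
      exists D1 x y D2, [/\ size D1 = s, (size D2 <= 1)%N & D = D1 ++ x :: y :: D2]].
Proof.
move=> D3; have [Ds|sD] := leqP (size D) s; first by constructor 1.
have st : size (take s D) = s by rewrite size_takel // ltnW.
have := size_drop s D; have := cat_take_drop s D.
case: (drop s D) => [|x [|y D2]] /= DE sd; first by lia.
  by constructor 2; exists (take s D), x; rewrite -cats1.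
constructor 3; exists (take s D), x, y, D2; split=> //.
lia.
Qed.

Lemma head_subset_list n y D : (y <= n)%N -> path ltn y D -> (last y D <= n)%N ->
  (size D <= 1)%N -> (y < head n.+1 D <= n.+1)%N.
Proof. by case: D => [|z []] //=; lia. Qed.

Lemma subset_list_cat3 n D1 x y D2 : subset_list n (D1 ++ x :: y :: D2) ->
  (size D2 <= 1)%N ->
  [/\ path ltn 0 D1, (last 0 D1 < x)%N, (x < y)%N, (y <= n)%N
    & (y < head n.+1 D2 <= n.+1)%N].
Proof.
rewrite /subset_list cat_path last_cat /= => /andP[/and4P[p1 x1 xy pD2] lD2] s2.
have yn : (y <= n)%N.
  by case: D2 pD2 lD2 s2 => [|z []] //= /andP[yz _] zn _; lia.
by split=> //; apply: head_subset_list.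
Qed.

Lemma subset_list_rcons n D x :
  subset_list n (rcons D x) = [&& path ltn 0 D, (last 0 D < x)%N & (x <= n)%N].
Proof. by rewrite /subset_list rcons_path last_rcons andbA. Qed.

(** With [j] parts, [n - j] is [x - s - 1] in Case II and [y - s - 1] in Case III, and the largest
    part does not exceed it. *)
Lemma lambda_delta_in_box s n D : subset_list n D -> (size D <= s + 3)%N ->
  partition_in_box n (lambda_delta s n D).
Proof.
move=> vD D3; rewrite partition_in_boxE -size_rev.
have pn k T T' : (T <= T')%N -> path leq T (nseq k T').
  by elim: k T => //= k IH T ->; rewrite IH.
have ln k (T : nat) : last T (nseq k T) = T by elim: k.
have ln' k T T' : (T <= T')%N -> (last T (nseq k T') <= T')%N.
  by case: k => //= k _; rewrite ln.
case: (seq_split3 D3) => [Ds|[D1 [x [D1s DE]]]|[D1 [x [y [D2 [D1s D2s DE]]]]]].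
- rewrite rev_lambda_delta_small // size_unshift last_unshift.
  case/andP: vD => pD lD; rewrite path_unshift // leq_sub2r // !andbT.
  exact: leq_trans (size_ltn_path pD) lD.
- move: vD; rewrite {}DE {D D3} subset_list_rcons => /and3P[pD xD xn].
  rewrite rev_lambda_delta_mid // cat_path path_unshift // pn // last_cat ln.
  rewrite size_cat size_unshift size_nseq last_unshift.
  by have := size_ltn_path pD; lia.
rewrite {}DE {D D3} in vD *.
have [pD xD xy yn /andP[yz zn]] := subset_list_cat3 vD D2s.
rewrite rev_lambda_delta_large // !cat_path path_unshift // pn // !last_cat ln /=.
have sD := size_ltn_path pD; have qA : (x - s <= y - s - 1)%N by lia.
rewrite pn // !size_cat /= size_unshift !size_nseq last_unshift.
have := ln' (head n.+1 D2 - y - 1)%N _ _ qA.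
lia.
Qed.

Lemma partition_key_cat s l e B : rev l = e ++ B -> size e = s ->
  partition_key s l = (s + size B, sumn e + sumn B, e)%N.
Proof.
move=> lE es; rewrite /partition_key -size_rev -sumn_rev lE take_size_cat //.
by rewrite size_cat es sumn_cat.
Qed.

Lemma partition_key_small s n D : (size D <= s)%N ->
  partition_key s (lambda_delta s n D) = (size D, sumn (unshift D), unshift D).
Proof.
move=> Ds; rewrite /partition_key -size_rev -sumn_rev rev_lambda_delta_small //.
by rewrite size_unshift take_oversize ?size_unshift.
Qed.

Lemma partition_key_mid s n D x : size D = s -> (x <= n)%N ->
  partition_key s (lambda_delta s n (rcons D x)) =
  (s + (n.+1 - x), sumn (unshift D) + last 0 (unshift D) * (n.+1 - x),
   unshift D)%N.
Proof.
move=> Ds xn; rewrite (partition_key_cat (rev_lambda_delta_mid Ds xn)).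
  by rewrite size_nseq sumn_nseq.
by rewrite size_unshift.
Qed.

(* With [T] the last part of the tail, [A = n - j] the largest part allowed and
   [m = n + 1 - y] parts outside the tail, the sum of those parts exceeds
   [m T + 1] by [p (A - T) + (x - s - T - 1)]: a Euclidean division by [A - T]. *)
Lemma partition_key_large s n D x y D' :
  subset_list n (D ++ x :: y :: D') -> size D = s -> (size D' <= 1)%N ->
  let T := last 0 (unshift D) in
  partition_key s (lambda_delta s n (D ++ x :: y :: D')) =
  (s + (n.+1 - y), sumn (unshift D) + (T * (n.+1 - y) +
     ((head n.+1 D' - y - 1) * (y - s - 1 - T) + (x - s - T.+1)).+1),
   unshift D)%N.
Proof.
move=> vD Ds D's T; have [pD xD xy yn /andP[yz zn]] := subset_list_cat3 vD D's.
have sD := size_ltn_path pD.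
rewrite (partition_key_cat (rev_lambda_delta_large x y Ds zn)) ?size_unshift //.
rewrite size_cat /= !size_nseq sumn_cat /= !sumn_nseq -/T.
have TE : (T = last 0 D - s)%N by rewrite /T last_unshift Ds.
congr (_, _, _); first by lia.
congr addn; rewrite TE; set z := head _ _ in yz zn *; set t := last 0 D in xD sD *.
(* Writing every quantity as a sum removes truncated subtraction. What remains is [T' q + (T' + 1 +
   v) + p (T' + w) = T' (p + q + 1) + (p w + v + 1)]. *)
have [p zE] : exists p, (z = y + 1 + p)%N by exists (z - y - 1)%N; lia.
have [q nE] : exists q, (n.+1 = z + q)%N by exists (n.+1 - z)%N; lia.
have [T' tE] : exists T', (t = s + T')%N by exists (t - s)%N; lia.
have [v xE] : exists v, (x = s + T' + 1 + v)%N by exists (x - s - T' - 1)%N; lia.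
have [w yE] : exists w, (y = s + 1 + T' + w)%N by exists (y - s - T' - 1)%N; lia.
rewrite nE zE.
have -> : (y + 1 + p + q - (y + 1 + p) = q)%N by lia.
have -> : (y + 1 + p + q - y = p + q + 1)%N by lia.
have -> : (y + 1 + p - y - 1 = p)%N by lia.
rewrite tE xE.
have -> : (s + T' - s = T')%N by lia.
have -> : (s + T' + 1 + v - s = T' + 1 + v)%N by lia.
have -> : (y - s - 1 = T' + w)%N by lia.
have -> : (T' + w - T' = w)%N by lia.
have -> : (T' + 1 + v - T'.+1 = v)%N by lia.
lia.
Qed.

(** * Keys determine subsets, and every key occurs *)

Lemma euclid_inj k p p' r r' : (r < k)%N -> (r' < k)%N ->
  (p * k + r = p' * k + r')%N -> p = p' /\ r = r'.
Proof.
move=> rk r'k E; have k0 : (0 < k)%N by apply: leq_ltn_trans rk.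
split; first by move/(congr1 (divn^~ k)): E; rewrite !divnMDl // !divn_small ?addn0.
by move/(congr1 (modn^~ k)): E; rewrite !modnMDl !modn_small.
Qed.

(** Different shapes have different keys: only Case I has at most [s] parts, and the sum outside the
    tail is minimal in Case II but not in Case III. *)
Lemma partition_key_lambda_delta_inj s n D D' :
  subset_list n D -> subset_list n D' ->
  (size D <= s + 3)%N -> (size D' <= s + 3)%N ->
  partition_key s (lambda_delta s n D) = partition_key s (lambda_delta s n D') ->
  D = D'.
Proof.
move=> vD vD' D3 D3'.
have unshift_inj E E' : path ltn 0 E -> path ltn 0 E' ->
    unshift E = unshift E' -> E = E'.
  by move=> pE pE' /(congr1 shift); rewrite !unshiftK.
case: (seq_split3 D3) => [Ds|[D1 [x [D1s DE]]]|[D1 [x [y [D2 [D1s D2s DE]]]]]];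
case: (seq_split3 D3') =>
  [Ds'|[D1' [x' [D1s' DE']]]|[D1' [x' [y' [D2' [D1s' D2s' DE']]]]]].
- rewrite !partition_key_small // => -[_ _]; apply: unshift_inj.
    by case/andP: vD.
  by case/andP: vD'.
- move: vD'; rewrite DE' subset_list_rcons => /and3P[_ _ xn].
  by rewrite partition_key_mid // partition_key_small // => -[]; lia.
- move: vD'; rewrite DE' => vD'; have [_ _ _ yn' _] := subset_list_cat3 vD' D2s'.
  by rewrite partition_key_large // partition_key_small // => -[]; lia.
- move: vD; rewrite DE subset_list_rcons => /and3P[_ _ xn].
  by rewrite partition_key_mid // partition_key_small // => -[]; lia.
- move: vD vD'; rewrite DE DE' !subset_list_rcons.
  move=> /and3P[pD _ xn] /and3P[pD' _ xn'].
  rewrite !partition_key_mid // => -[sE _ /unshift_inj ->] //.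
  by congr rcons; lia.
- move: vD vD'; rewrite DE DE' subset_list_rcons => /and3P[pD _ xn] vD'.
  rewrite partition_key_mid // partition_key_large // => -[sE + DD'].
  rewrite -DD'; have -> : (n.+1 - y' = n.+1 - x)%N by lia.
  (* After cancellation, [0] would equal the successor coming from Case III. *)
  by move/addnI/eqP; rewrite -{1}(addn0 (_ * _)%N) eqn_add2l.
- move: vD; rewrite DE => vD; have [_ _ _ yn _] := subset_list_cat3 vD D2s.
  by rewrite partition_key_large // partition_key_small // => -[]; lia.
- move: vD vD'; rewrite DE DE' subset_list_rcons => vD /and3P[pD _ xn].
  rewrite partition_key_mid // partition_key_large // => -[sE + DD'].
  rewrite DD'; have -> : (n.+1 - y = n.+1 - x')%N by lia.
  by move/addnI/esym/eqP; rewrite -{1}(addn0 (_ * _)%N) eqn_add2l.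
rewrite {}DE {}DE' in vD vD' *.
have [pD xD xy yn /andP[yz zn]] := subset_list_cat3 vD D2s.
have [pD' xD' xy' yn' /andP[yz' zn']] := subset_list_cat3 vD' D2s'.
rewrite !partition_key_large // => -[sE + /(unshift_inj _ _ pD pD') DD'].
rewrite -{}DD' in xD' {pD'} *; have sD := size_ltn_path pD.
have {sE} yE : y' = y by lia.
rewrite {y'}yE in vD' xy' yn' yz' *.
(* The remainders are below the common divisor because [x < y] and [x' < y]. *)
move/addnI/addnI => -[]; rewrite !last_unshift D1s => /euclid_inj[].
- by lia.
- by lia.
move=> zE xE; have {xE} -> : x = x' by lia.
have {zE} : head n.+1 D2 = head n.+1 D2' by lia.
(* If just one of the lists were empty, the other would contain [n + 1]. *)
case: D2 D2s vD {yz zn} => [|z []] // _ vD;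
case: D2' D2s' vD' {yz' zn'} => [|z' []] // _ vD' /= zE.
- by move: vD'; rewrite /subset_list last_cat /= -zE ltnn andbF.
- by move: vD; rewrite /subset_list last_cat /= zE ltnn andbF.
by rewrite zE.
Qed.

(** Applied to the parts outside the tail, this gives the range of their sum. *)
Lemma sumn_bounds T A (B : seq nat) : path leq T B -> (last T B <= A)%N ->
  (T * size B <= sumn B <= A * size B)%N.
Proof.
elim: B T => [|r B IH] T /=; first by rewrite !muln0.
move=> /andP[Tr pB] lB; have /andP[h1 h2] := IH _ pB lB.
have rA : (r <= A)%N.
  apply: leq_trans lB; have [->//|nz] := eqVneq B [::].
  have /allP := order_path_min leq_trans pB.
  by apply; case: B nz {pB IH h1 h2} => // u B _; rewrite /= mem_last.
rewrite !mulnS; apply/andP; split; apply: leq_add => //.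
by apply: leq_trans h1; rewrite leq_mul2r Tr orbT.
Qed.

Lemma partition_key_lambda_delta_surj s n l : partition_in_box n l ->
  exists D, [/\ subset_list n D, (size D <= s + 3)%N &
    partition_key s (lambda_delta s n D) = partition_key s l].
Proof.
rewrite partition_in_boxE => /and3P[ln pl bl].
have [ls|sl] := leqP (size l) s.
  exists (shift (rev l)); split.
  - by rewrite /subset_list path_shift // last_shift size_rev; lia.
  - by rewrite size_shift size_rev; lia.
  rewrite partition_key_small ?size_shift ?size_rev // shiftK.
  by rewrite /partition_key take_oversize ?size_rev // sumn_rev.
set e := take s (rev l); set B := drop s (rev l).
have lE : rev l = e ++ B by rewrite cat_take_drop.
have es : size e = s by rewrite size_takel // size_rev ltnW.
have mE : (s + size B = size l)%N by rewrite -es -size_cat -lE size_rev.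
rewrite (partition_key_cat lE es).
move: pl bl; rewrite lE cat_path last_cat => /andP[pe pB] lB.
have /andP[] := sumn_bounds pB lB.
(* Since [s < size l], [B] is nonempty and its last part dominates the last part of the tail. *)
have {lB pB} : (last 0 e <= n - size l)%N.
  apply: leq_trans lB; have : (0 < size B)%N by lia.
  case: B pB {lE mE} => //= r B /andP[Tr /(order_path_min leq_trans) /allP h] _.
  apply: leq_trans Tr _; have := mem_last r B.
  by rewrite inE => /orP[/eqP ->|/h].
set T := last 0 e; set m := size B in mE *; set N := sumn B => TA N1 N2.
(* The minimal sum is that of Case II; the element [n + 1 - m] yields [m] parts outside the tail. *)
have [NE|NE] := eqVneq N (T * m)%N.
  exists (rcons (shift e) (n.+1 - m)); split.
  - rewrite subset_list_rcons path_shift // last_shift es -/T; lia.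
  - by rewrite size_rcons size_shift es; lia.
  rewrite partition_key_mid ?size_shift //; last by lia.
  rewrite shiftK -/T NE; congr (_, _, _); first lia.
  by congr (_ + _ * _)%N; lia.
(* Here [N] exceeds [T * m], so the predecessor is genuine and makes the bound [v < m * k]
   strict. *)
set k := (n - size l - T)%N; set v := (N - T * m).-1.
have vE : (N = T * m + v.+1)%N by lia.
have vk : (v < m * k)%N.
  have : (m * k = (n - size l) * m - T * m)%N by rewrite /k mulnC mulnBl.
  lia.
have k0 : (0 < k)%N by case: k vk => //; rewrite muln0.
pose p := (v %/ k)%N; pose r := (v %% k)%N.
have pm : (p < m)%N by rewrite ltn_divLR.
have rk : (r < k)%N by rewrite ltn_mod.
(* These values invert [partition_key_large]: [y] encodes [m], [x] the remainder and [z] the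
   quotient. As [p < m], [z] is at most [n + 1], and that value stands for an absent element. *)
pose x := (T.+1 + r + s)%N; pose y := (n.+1 - m)%N; pose z := (y.+1 + p)%N.
pose D2 := if z == n.+1 then [::] else [:: z].
have hz : head n.+1 D2 = z by rewrite /D2; case: eqP.
have D2s : (size D2 <= 1)%N by rewrite /D2; case: eqP.
have vD : subset_list n (shift e ++ [:: x, y & D2]).
  rewrite /subset_list cat_path last_cat /= path_shift // last_shift es -/T.
  rewrite /D2; case: eqP => zn /=; rewrite /x /y /z /k in rk zn *; lia.
exists (shift e ++ [:: x, y & D2]); split=> //.
  by rewrite size_cat size_shift es /=; lia.
rewrite partition_key_large // ?size_shift // shiftK -/T hz.
have -> : (n.+1 - y = m)%N by rewrite /y; lia.
have -> : (z - y - 1 = p)%N by rewrite /z; lia.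
have -> : (x - s - T.+1 = r)%N by rewrite /x; lia.
have -> : (y - s - 1 - T = k)%N by rewrite /y /k; lia.
by rewrite -divn_eq -vE.
Qed.

(** * Chambers and addresses *)

Local Open Scope classical_set_scope.
Local Open Scope ring_scope.

Lemma sgr_neq_inj (R : realDomainType) (a b c : R) : a != 0 -> b != 0 -> c != 0 ->
  (Num.sg a != Num.sg b) = (Num.sg a != Num.sg c) -> Num.sg b = Num.sg c.
Proof.
have n1 : (1 == -1 :> R) = false by apply/eqP; lra.
case: (sgrP a) => //; case: (sgrP b) => //; case: (sgrP c) => //=.
all: by rewrite ?eqxx // ?[-1 == 1]eq_sym ?n1.
Qed.

Section Chambers.
Variables (R : realType) (n d : nat).
Implicit Types (x y : 'rV[R]_d) (C : set 'rV[R]_d).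

Lemma arrangement_complementP x :
  arrangement_complement n x <->
  forall i, (0 < i <= n)%N -> (point_poly x).[i%:R] != 0.
Proof.
split=> [Sx i iN|h [i /= iN]]; last first.
  by rewrite /hyperplane /= -horner_point_poly => /eqP; rewrite (negPf (h i iN)).
apply/eqP => xi; apply: Sx; exists i => //.
by rewrite /hyperplane /= -horner_point_poly.
Qed.

Lemma chamber_xget C : chambers n C ->
  arrangement_complement n (xget 0 C) /\
  C = connected_component (@arrangement_complement R n d) (xget 0 C).
Proof.
move=> [z Sz <-]; set C' := connected_component _ _.
have Cx : C' (xget 0 C').
  by case: xgetP => [w _ //|/(_ z) []]; exact: connected_component_refl.
split; first exact: connected_component_sub Cx.
exact: same_connected_component.
Qed.

(** Evaluation at [0], where the polynomial is [1], supplies the leading sign [+]. *)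
Definition address_at x : seq nat :=
  [seq i <- iota 1 n |
    Num.sg (point_poly x).[i.-1%:R] != Num.sg (point_poly x).[i%:R]].

Lemma horner_point_poly0 x : (point_poly x).[0] = 1.
Proof.
rewrite horner_point_poly big1 ?addr0 // => k _.
by rewrite expr0n mul0r.
Qed.

Lemma addressE C x : sign_word n C = sign_word_at n x ->
  address n C = address_at x.
Proof.
rewrite /address => ->.
have wE i : (i <= n)%N ->
    (1 :: sign_word_at n x)`_i = Num.sg (point_poly x).[i%:R].
  case: i => [|i] iN; first by rewrite horner_point_poly0 sgr1.
  by rewrite /= (nth_map 0) ?size_iota // nth_iota.
apply/eq_in_filter => i; rewrite mem_iota => /andP[i0 iN].
by rewrite !wE //; lia.
Qed.

(** From the common sign at [0] onwards, the address tells at each integer whether the sign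
    flips. *)
Lemma address_at_inj x y :
  arrangement_complement n x -> arrangement_complement n y ->
  address_at x = address_at y -> forall i, (i <= n)%N ->
  Num.sg (point_poly x).[i%:R] = Num.sg (point_poly y).[i%:R].
Proof.
move=> /arrangement_complementP Sx /arrangement_complementP Sy xy.
elim=> [_|i IH iN]; first by rewrite !horner_point_poly0.
have /(congr1 (fun s => i.+1 \in s)) := xy; rewrite !mem_filter mem_iota.
rewrite /= IH ?(ltnW iN) // add1n ltnS iN !andbT.
apply: sgr_neq_inj; [|exact: Sx|exact: Sy].
case: i {IH} iN => [|i] iN; first by rewrite horner_point_poly0 oner_neq0.
by apply: Sy; lia.
Qed.

(* The complement conditions are affine in the point, so sign-equal points are
   joined by a segment that avoids every hyperplane. *)
Lemma connected_component_same_sign x y :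
  arrangement_complement n x -> arrangement_complement n y ->
  (forall i, (i <= n)%N ->
    Num.sg (point_poly x).[i%:R] = Num.sg (point_poly y).[i%:R]) ->
  connected_component (@arrangement_complement R n d) x y.
Proof.
move=> /arrangement_complementP Sx /arrangement_complementP Sy xy.
pose f (t : R) : 'rV[R]_d := x + t *: (y - x).
have cf : continuous f.
  move=> t; apply: (@continuousD R 'rV[R]_d R (cst x) ( *:%R^~ (y - x))).
    exact: cst_continuous.
  exact: scalel_continuous.
have fE t u : (point_poly (f t)).[u] =
    (1 - t) * (point_poly x).[u] + t * (point_poly y).[u].
  rewrite !horner_point_poly !mulrDr !mulr1 addrACA subrK !mulr_sumr -big_split.
  by congr (_ + _); apply: eq_bigr => k _; rewrite !mxE /=; ring.
exists (f @` `[0, 1]); last first.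
  exists 1; first by rewrite /= in_itv /= ler01 lexx.
  by rewrite /f scale1r addrC subrK.
split.
- exists 0; first by rewrite /= in_itv /= ler01 lexx.
  by rewrite /f scale0r addr0.
- move=> _ [t /= + <-]; rewrite in_itv /= => /andP[t0 t1].
  apply/arrangement_complementP => i iN; rewrite fE.
  have := xy i; case/andP: (iN) => _ -> /(_ isT).
  have := Sx i iN; have := Sy i iN; set a := _.[_]; set b := _.[_].
  (* Equal signs make the convex combination nonzero; opposite signs contradict [ab]. *)
  case: (sgrP a); case: (sgrP b); rewrite ?eqxx // => b0 a0 _ _ ab;
    by apply/eqP => E; first [lra | nra].
apply: connected_continuous_connected; first exact: segment_connected.
exact: continuous_subspaceT.
Qed.

End Chambers.

(** * Addresses are the subsets with at most [d] elements *)

Lemma size_point_poly (R : realType) (d : nat) (x : 'rV[R]_d) :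
  (size (point_poly x) <= d.+1)%N.
Proof.
apply: leq_trans (size_polyD _ _) _; rewrite size_poly1 geq_max /=.
apply: leq_trans (size_sum _ _ _) _; apply/bigmax_leqP => k _.
by apply: leq_trans (size_scale_leq _ _) _; rewrite size_polyXn ltnS.
Qed.

Lemma size_address_at (R : realType) (n d : nat) (x : 'rV[R]_d) :
  arrangement_complement n x -> (size (address_at n x) <= d)%N.
Proof.
move=> /arrangement_complementP Sx; set p := point_poly x.
have p0 : p != 0.
  apply: contra_eq_neq (horner_point_poly0 x) => p0.
  by rewrite -/p p0 horner0 eq_sym oner_neq0.
(* [g] picks a root strictly between [i - 1] and [i] for each sign change [i]; these intervals are
   disjoint, so the roots are distinct. *)
have /choice[g gP] (i : nat) : exists r : R, i \in address_at n x ->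
    i.-1%:R < r < i%:R /\ root p r.
  have [iA|] := boolP (i \in address_at n x); last by exists 0.
  move: (iA); rewrite mem_filter mem_iota => /and3P[sgi i0 iN].
  have [||r] := @poly_ivtoo _ p i.-1%:R i%:R.
  - by rewrite ler_nat leq_pred.
  - have := Sx i; rewrite i0 -ltnS -add1n => /(_ iN); move: sgi; rewrite -/p.
    have : p.[i.-1%:R] != 0.
      have [->|i1] := posnP i.-1; first by rewrite horner_point_poly0 oner_neq0.
      apply: Sx; lia.
    case: (sgrP p.[i.-1%:R]) => //; case: (sgrP p.[i%:R]) => //; rewrite ?eqxx //.
      by move=> ? ? *; rewrite pmulr_rlt0.
    by move=> ? ? *; rewrite nmulr_rlt0.
  by rewrite in_itv /= => ir rr; exists r.
rewrite -(size_map g) -ltnS; apply: leq_trans (size_point_poly x).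
apply: max_poly_roots => //.
  by apply/allP => _ /mapP[i /gP[_ ?] ->].
rewrite map_inj_in_uniq ?filter_uniq ?iota_uniq // => i j iA jA gij.
have [/andP[i1 i2] _] := gP _ iA; have [/andP[j1 j2] _] := gP _ jA.
rewrite -gij in j1 j2.
have := lt_trans i1 j2; have := lt_trans j1 i2; rewrite !ltr_nat.
move: iA jA; rewrite !mem_filter !mem_iota; lia.
Qed.

Lemma subset_list_address_at (R : realType) (n d : nat) (x : 'rV[R]_d) :
  subset_list n (address_at n x).
Proof.
have /allP aA : all (fun i => 0 < i <= n)%N (address_at n x).
  by apply/allP => i; rewrite mem_filter mem_iota; lia.
have srt : sorted ltn (address_at n x).
  by apply: sorted_filter; [exact: ltn_trans|exact: iota_ltn_sorted].
rewrite /subset_list path_min_sorted ?srt /=; last first.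
  by apply/allP => i /aA/andP[].
by have := mem_last 0 (address_at n x); rewrite inE => /orP[/eqP ->|/aA/andP[]].
Qed.

Lemma point_poly_surj (R : realType) (d : nat) (p : {poly R}) :
  p.[0] = 1 -> (size p <= d.+1)%N -> exists x : 'rV[R]_d, point_poly x = p.
Proof.
move=> p0 sp; exists (\row_k p`_k.+1); apply/polyP => i.
rewrite coefD coef1 coef_sum; case: i => [|i].
  rewrite big1 ?addr0 -?horner_coef0 ?p0 // => k _.
  by rewrite coefZ coefXn mulr0.
rewrite add0r; have [id|di] := ltnP i d.
  rewrite (bigD1 (Ordinal id)) //= coefZ coefXn eqxx mulr1 mxE big1 ?addr0 //.
  move=> k /eqP ki; rewrite coefZ coefXn eqSS.
  by case: eqP => [ik|]; [case: ki; apply/val_inj|rewrite mulr0].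
rewrite nth_default ?big1 // => [k _|]; last exact: leq_trans sp _.
by rewrite coefZ coefXn eqSS gtn_eqF ?mulr0 // (leq_trans (ltn_ord k)).
Qed.

Lemma address_at_surj (R : realType) (n d : nat) (D : seq nat) :
  subset_list n D -> (size D <= d)%N ->
  exists2 x : 'rV[R]_d, arrangement_complement n x & address_at n x = D.
Proof.
move=> /andP[pD lD] sD.
have srt : sorted ltn D by exact: path_sorted pD.
have D0 : 0%N \notin D.
  by apply/negP => /(allP (order_path_min ltn_trans pD)).
have DN i : i \in D -> (i <= n)%N.
  move=> iD; apply: leq_trans lD; move: iD pD.
  elim/last_ind: {srt D0 sD} D => // D t IH.
  rewrite mem_rcons inE rcons_path last_rcons => /orP[/eqP ->//|/IH h].
  by move=> /andP[/h lD ?]; apply: leq_trans lD _; apply: ltnW.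
(* Half-integers avoid the integers and are positive for [c >= 1]. The factors below are scaled to
   be [1] at [0]. *)
pose g (c : nat) : R := c%:R - 2^-1.
pose p : {poly R} := \prod_(c <- D) (1 - (g c)^-1 *: 'X).
have pE u : p.[u] = \prod_(c <- D) (1 - (g c)^-1 * u).
  by rewrite horner_prod; apply: eq_bigr => c _; rewrite !hornerE.
have gc c i : c \in D -> Num.sg (1 - (g c)^-1 * i%:R) = (-1) ^+ (c <= i)%N.
  move=> cD; have c0 : (0 < c)%N by case: c cD => //; rewrite (negPf D0).
  have c1 : 1 <= c%:R :> R by rewrite ler1n.
  have g0 : 0 < g c by rewrite /g; lra.
  have -> : 1 - (g c)^-1 * i%:R = (g c)^-1 * (g c - i%:R).
    by rewrite mulrBr mulVf // gt_eqF.
  rewrite sgrM gtr0_sg ?invr_gt0 // mul1r /g; case: leqP => ci.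
    by rewrite ltr0_sg //; move: ci; rewrite -(ler_nat R); lra.
  by rewrite gtr0_sg //; move: ci; rewrite -(ler_nat R) -natr1; lra.
(* Exactly the factors with [c <= i] are negative at [i]. *)
have sgp i : Num.sg p.[i%:R] = (-1) ^+ (count (fun c => c <= i)%N D).
  rewrite pE; elim: (D) (gc) => [|c E IH] gcE; first by rewrite big_nil sgr1.
  rewrite big_cons sgrM gcE ?mem_head // IH ?exprD // => c' j c'E.
  by apply: gcE; rewrite inE c'E orbT.
have p01 : p.[0] = 1 by rewrite pE big1 // => c _; rewrite mulr0 subr0.
have sp : (size p <= d.+1)%N.
  apply: leq_trans (_ : (size D).+1 <= _)%N => //; rewrite /p.
  elim: (D) => [|c E IH]; first by rewrite big_nil size_poly1.
  rewrite big_cons; apply: leq_trans (size_polyMleq _ _) _.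
  have : (size (1 - (g c)^-1 *: 'X)%R <= 2)%N.
    apply: leq_trans (size_polyD _ _) _; rewrite size_poly1 geq_max /= size_polyN.
    by apply: leq_trans (size_scale_leq _ _) _; rewrite size_polyX.
  by move=> h; rewrite -subn1 leq_subLR; apply: leq_trans (leq_add h IH) _.
have [x xp] := point_poly_surj p01 sp; exists x.
  apply/arrangement_complementP => i _.
  by rewrite xp -sgr_eq0 sgp signr_eq0.
apply: (irr_sorted_eq ltn_trans ltnn) => //.
  by apply: sorted_filter; [exact: ltn_trans|exact: iota_ltn_sorted].
move=> i; rewrite mem_filter mem_iota xp !sgp.
have [->|i0] := posnP i; first by rewrite (negPf D0) andbF.
(* The count grows from [i - 1] to [i] exactly when [i] is in [D], so the sign flips there and
   nowhere else. *)
have cE : count (fun c => c <= i)%N D = (count (fun c => c <= i.-1)%N D + (i \in D))%N.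
  have uD : uniq D by apply: sorted_uniq srt; [exact: ltn_trans|exact: ltnn].
  rewrite -(count_uniq_mem _ uD) -count_predUI (_ : count (predI _ _) D = 0%N).
    by rewrite addn0; apply: eq_count => c /=; lia.
  by apply/eqP; rewrite -leqn0 leqNgt -has_count; apply/hasPn => c _ /=; lia.
rewrite cE exprD -{1}[_ ^+ _]mulr1 (inj_eq (mulfI _)) ?signr_eq0 //.
case iD: (i \in D); last by rewrite expr0 eqxx.
rewrite expr1 /= add1n ltnS DN ?iD //.
by rewrite andbT; apply/eqP; lra.
Qed.

Theorem theorem2 (R : realType) (n d : nat) (hn : (1 <= n)%N) (hd : (3 <= d)%N) :
  set_bij (@chambers R n d) (@approx_classes n (d - 3)%N)
    (@chamber_class R n d (d - 3)%N).
Proof.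
set s := (d - 3)%N; have sd : (s + 3 = d)%N by rewrite subnK.
have adE (C : set 'rV[R]_d) : chambers n C -> address n C = address_at n (xget 0 C).
  by move=> chC; apply: addressE.
split.
- by move=> C _; exists (word_of_partition n (lambda_delta s n (address n C))).
(* Equal classes give equal keys, then equal addresses, equal signs at the two representatives, and
   a common component. *)
- move=> C1 C2; rewrite !inE => ch1 ch2.
  have [S1 E1] := chamber_xget ch1; have [S2 E2] := chamber_xget ch2.
  rewrite /chamber_class !adE //.
  have a1 := subset_list_address_at n (xget 0 C1).
  have a2 := subset_list_address_at n (xget 0 C2).
  have s1 : (size (address_at n (xget 0%R C1)) <= s + 3)%N.
    by rewrite [leqRHS]sd size_address_at.
  have s2 : (size (address_at n (xget 0%R C2)) <= s + 3)%N.
    by rewrite [leqRHS]sd size_address_at.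
  move=> /approx_class_eq.
  rewrite !lambda_of_word_of_partition; try exact: lambda_delta_in_box.
  move=> /(partition_key_lambda_delta_inj a1 a2 s1 s2) /(address_at_inj S1 S2).
  move=> /(connected_component_same_sign S1 S2) /same_connected_component.
  by rewrite -E1 -E2.
(* Some subset has the key of [w]; it is the address of a point, whose component is the required
   chamber. *)
move=> _ [w _ <-].
have := lambda_of_word_in_box w; rewrite size_tuple => bw.
have [D [vD sD kD]] := partition_key_lambda_delta_surj s bw.
rewrite sd in sD; have [x Sx xD] := @address_at_surj R n d D vD sD.
have Cx := connected_component_refl Sx.
set C := connected_component _ x in Cx.
have chC : chambers n C by exists x.
exists C => //; rewrite /chamber_class (addressE (sign_word_indep chC Cx)) xD.
apply/approx_class_eq; rewrite lambda_of_word_of_partition ?kD //.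
by apply: lambda_delta_in_box => //; rewrite sd.
Qed.
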